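(* Let $(X,\Gamma)$ be a minimal dynamical system such that $E=E(X,\Gamma)$ is metrizable. Then: (1) there is a unique minimal left ideal $I\subset E$, and $E(X,\Gamma)\cong E(I,\Gamma)$; (2) the Polish group $K={\rm Aut}(I,\Gamma)$ of automorphisms of the system $(I,\Gamma)$, with the topology of uniform convergence, is compact; (3) the quotient dynamical system $(I/K,\Gamma)$ is proximal; (4) the quotient map $\pi:I\to I/K$ is a $K$-extension (group extension by $K$); (5) if in addition $(X,\Gamma)$ is incontractible then $I/K$ is trivial, $I$ is identified with $K$, and $\Gamma$ acts on $K$ by translations via a continuous homomorphism $J:\Gamma\to K$ with $J(\Gamma)$ dense in $K$; in particular $(I,\Gamma)$, and hence $(X,\Gamma)$, is equicontinuous; (6) if $\Gamma$ is commutative then $X=I=K$ and $K=\overline{J(\Gamma)}$ is a commutative compact group.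
   Context: A dynamical system $(X,\Gamma)$: compact Hausdorff $X$ with a continuous action of a topological group $\Gamma$. The enveloping semigroup $E(X,\Gamma)$ is the pointwise closure in $X^X$ of $\{x\mapsto\gamma x:\gamma\in\Gamma\}$, a compact semigroup under composition on which $\Gamma$ acts by left multiplication; a minimal left ideal $I\subset E$ is a closed minimal $\Gamma$-invariant subset, giving the system $(I,\Gamma)$. A system is proximal if every pair of points $x,y$ is proximal (there is a net $\gamma_i$ with $\lim\gamma_i x=\lim\gamma_i y$). A $K$-extension $\pi:I\to I/K$ means $K$ is a compact group of automorphisms acting freely on $I$ and $\pi$ is the quotient map onto the orbit space. A minimal system is incontractible if for every $n$ the almost periodic points (points with minimal orbit closure) are dense in $X^n$. *)

(* Defs.v *)
From HB Require Import structures.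
From mathcomp Require Import all_boot all_order all_algebra.
From mathcomp Require Import all_classical all_reals topology Rstruct.
Import Order.TTheory GRing.Theory Num.Theory.
Local Open Scope classical_set_scope.
Local Open Scope ring_scope.

Definition is_topgroup {G : topologicalType} (mul : G -> G -> G) (inv : G -> G)
    (one : G) : Prop :=
  [/\ associative mul, left_id one mul, right_id one mul,
      (forall g, mul (inv g) g = one) & (forall g, mul g (inv g) = one)] /\
  continuous (fun p : G * G => mul p.1 p.2) /\ continuous inv.

Definition ds_action {G : topologicalType} (mul : G -> G -> G) (one : G)
    {T : topologicalType} (a : G -> T -> T) : Prop :=
  [/\ continuous (fun p : G * T => a p.1 p.2),
      (forall x, a one x = x) &
      (forall g h x, a (mul g h) x = a g (a h x))].

Definition dyn_system {G : topologicalType} (mul : G -> G -> G) (one : G)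
    {T : topologicalType} (a : G -> T -> T) : Prop :=
  [/\ compact [set: T], hausdorff_space T & ds_action mul one a].

Section DynDefs.
Context {G : topologicalType}.

Definition ds_invariant {T : Type} (a : G -> T -> T) (A : set T) : Prop :=
  forall g x, A x -> A (a g x).

Definition minimal_subset {T : topologicalType} (a : G -> T -> T) (A : set T)
    : Prop :=
  [/\ A !=set0, closed A, ds_invariant a A &
      forall B, B `<=` A -> B !=set0 -> closed B -> ds_invariant a B -> B = A].

Definition minimal_system {T : topologicalType} (a : G -> T -> T) : Prop :=
  minimal_subset a [set: T].

Definition ds_orbit {T : Type} (a : G -> T -> T) (x : T) : set T :=
  range (fun g => a g x).

Definition almost_periodic {T : topologicalType} (a : G -> T -> T) (x : T)
    : Prop :=
  minimal_subset a (closure (ds_orbit a x)).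

Definition diag_act {T : Type} (n : nat) (a : G -> T -> T) :
    G -> {ptws 'I_n -> T} -> {ptws 'I_n -> T} :=
  fun g v i => a g (v i).

Definition incontractible {T : topologicalType} (a : G -> T -> T) : Prop :=
  minimal_system a /\
  forall n : nat, dense [set v : {ptws 'I_n -> T} | almost_periodic (@diag_act T n a) v].

(** proximality, with nets rendered as proper filters on G *)
Definition proximal_pair {T : topologicalType} (a : G -> T -> T) (x y : T)
    : Prop :=
  exists F : set_system G, ProperFilter F /\
    exists z : T, (fun g => a g x) @ F --> z /\ (fun g => a g y) @ F --> z.

Definition proximal {T : topologicalType} (a : G -> T -> T) : Prop :=
  forall x y, proximal_pair a x y.

Definition equicontinuous_system {T : uniformType} (a : G -> T -> T) : Prop :=
  forall (x : T) (U : set (T * T)), entourage U ->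
    \forall y \near x, forall g, U (a g x, a g y).

Definition enveloping {T : topologicalType} (a : G -> T -> T)
    : set {ptws T -> T} :=
  closure (range (fun g => (a g : {ptws T -> T}))).

Definition lmul {T : Type} (a : G -> T -> T) :
    G -> {ptws T -> T} -> {ptws T -> T} :=
  fun g p => (a g \o p : {ptws T -> T}).

Definition minimal_left_ideal {T : topologicalType} (a : G -> T -> T)
    (I : set {ptws T -> T}) : Prop :=
  I `<=` enveloping a /\ minimal_subset (lmul a) I.

(** restriction of an action to a subset Y (the genuine restriction
    whenever Y is invariant) *)
Definition ds_restrict {T : Type} (a : G -> T -> T) (Y : set T) :
    G -> set_type Y -> set_type Y :=
  fun g y => match pselect (Y (a g (val y))) with
             | left h => exist (fun z => z \in Y) (a g (val y)) (mem_set h)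
             | right _ => y
             end.

End DynDefs.

Definition homeo {S T : topologicalType} (f : S -> T) : Prop :=
  continuous f /\ exists g : T -> S, [/\ continuous g, cancel f g & cancel g f].

Definition ds_automorphism {G : Type} {T : topologicalType} (b : G -> T -> T)
    (k : T -> T) : Prop :=
  homeo k /\ forall g x, k (b g x) = b g (k x).

Definition ds_Aut {G : Type} {T : uniformType} (b : G -> T -> T)
    : set {uniform T -> T} :=
  [set k | ds_automorphism b k].

Definition enveloping_iso {G : topologicalType} {T S : topologicalType}
    (a : G -> T -> T) (b : G -> S -> S) : Prop :=
  exists phi : set_type (enveloping a) -> set_type (enveloping b),
  [/\ homeo phi,
      (forall p q r : set_type (enveloping a),
          val r = val p \o val q -> val (phi r) = val (phi p) \o val (phi q)) &
      (forall g (p : set_type (enveloping a)),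
          val p = (a g : {ptws T -> T}) -> val (phi p) = (b g : {ptws S -> S}))].

(** (Y, c) together with pi : T -> Y is the quotient system (T/K, G) and
    pi : T -> T/K is a K-extension: K acts freely on T, the fibres of pi are
    exactly the K-orbits, Y carries the quotient topology, and (Y, c) is a
    dynamical system with pi equivariant. *)
Definition K_extension {G : topologicalType} (mul : G -> G -> G) (one : G)
    {T : topologicalType} (b : G -> T -> T) (K : set (T -> T))
    {Y : topologicalType} (c : G -> Y -> Y) (pi : T -> Y) : Prop :=
  [/\ dyn_system mul one c,
      continuous pi, (forall y, exists x, pi x = y),
      (forall g x, pi (b g x) = c g (pi x)) &
      (forall x x', pi x = pi x' <-> exists2 k, K k & x' = k x)] /\
  (forall A : set Y, open A <-> open (pi @^-1` A)) /\
  (forall k x, K k -> k x = x -> k = id).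

Definition translation_model {G : topologicalType} (mul : G -> G -> G)
    {T : uniformType} (b : G -> T -> T) (K : set {uniform T -> T}) : Prop :=
  exists (theta : set_type K -> T) (J : G -> {uniform T -> T}),
  [/\ homeo theta,
      (forall g, K (J g)),
      continuous J,
      (forall g h, J (mul g h) = (J g \o J h : {uniform T -> T})) &
      K `<=` closure (range J)] /\
      (forall g (k k' : set_type K),
          val k' = (J g \o val k : {uniform T -> T}) ->
          b g (theta k) = theta k').

Definition metrizable (T : topologicalType) : Prop :=
  exists d : T -> T -> Rdefinitions.R,
  [/\ forall x y, d x y = 0 <-> x = y,
      forall x y, d x y = d y x,
      forall x y z, d x z <= d x y + d y z &
      forall A : set T, open A <->
        forall x, A x -> exists2 e : Rdefinitions.R, 0 < e & [set y | d x y < e] `<=` A].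

(* Main.v *)
Require Import Defs.
From HB Require Import structures.
From mathcomp Require Import all_boot all_order all_algebra.
From mathcomp Require Import all_classical all_reals topology Rstruct.
Import Order.TTheory GRing.Theory Num.Theory.
Local Open Scope classical_set_scope.

(** A minimal system with metrizable enveloping semigroup [E] is already
    equicontinuous.  Fix a closed entourage [W] and a metric [d] on [E].
    Evaluation at a point is uniformly continuous on [E], so [X] is the union
    of the closed sets
    [A_n = {x | forall g h, d g h < 1/(n+1) -> W (g x, h x)}];
    by Baire one of them has an interior point [x0], and total boundedness of
    [E] makes [x0] a point of equicontinuity up to [W].  Minimality moves this
    to every point.  Equicontinuity turns [E] into a compact Hausdorff
    topological group with a dense image of [G], so [E] is its own unique
    minimal left ideal, the automorphisms of [(E, G)] are the right
    translations, and they act simply transitively: [I = E], [K] is [E] up to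
    inversion, and [I/K] is a point, whether or not [(X, G)] is
    incontractible.  When [G] is commutative so is [E], and evaluation at any
    point of [X] is a homeomorphism from [E] onto [X]. *)

(** * Topological preliminaries: closed sets, compact images, pointwise convergence *)

Lemma closed_eq_continuous {S T : topologicalType} (f g : S -> T) :
  hausdorff_space T -> continuous f -> continuous g ->
  closed [set s | f s = g s].
Proof.
move=> hT cf cg s cls; apply: hT => A B fsA gsB.
have nAB : nbhs s (f @^-1` A `&` g @^-1` B).
  by apply: filterI; [exact: cf|exact: cg].
have [t [/= fgt [At Bt]]] := cls _ nAB.
by exists (f t); split => //; rewrite fgt.
Qed.

Lemma compact_image {S T : topologicalType} (f : S -> T) (A : set S) :
  continuous f -> compact A -> compact (f @` A).
Proof. by move=> cf; apply: continuous_compact; exact: continuous_subspaceT. Qed.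

Lemma compact_bijection_homeo {S T : topologicalType} (f : S -> T) (g : T -> S) :
  compact [set: S] -> hausdorff_space T -> continuous f ->
  cancel f g -> cancel g f -> homeo f.
Proof.
move=> cS hT cf fK gK; split=> //; exists g; split=> //.
apply/continuous_closedP => A cA.
have -> : g @^-1` A = f @` A.
  by apply/seteqP; split => [t At|_ [s As <-]]; [exists (g t)|rewrite /= fK].
apply: compact_closed => //; apply: compact_image => //.
exact: subclosed_compact cA cS _.
Qed.

(** Used to eliminate an existential quantifier over a compact space while keeping the set closed:
    for continuity of inversion and for existence of inverses. *)
Lemma closed_fst_image {S T : topologicalType} (C : set (S * T)) :
  hausdorff_space S -> compact [set: S] -> compact [set: T] ->
  closed C -> closed (fst @` C).
Proof.
move=> hS cS cT cC; apply: compact_closed => //.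
apply: compact_image; first by move=> ?; exact: cvg_fst.
apply: subclosed_compact cC _ (_ : _ `<=` setT) => //.
by rewrite -setXTT; exact: compact_setX.
Qed.

Lemma continuous_pair {S T U : topologicalType} (f : S -> T) (g : S -> U) :
  continuous f -> continuous g -> continuous (fun s => (f s, g s)).
Proof. by move=> cf cg s; apply: cvg_pair; [exact: cf|exact: cg]. Qed.

Lemma ptws_continuous {S T : topologicalType} {V : uniformType} (f : S -> {ptws T -> V}) :
  (forall x, continuous (fun s => f s x)) -> continuous f.
Proof. by move=> cf s; apply/pointwise_cvgP => x; exact: cf. Qed.

(** * Compact groups with a dense homomorphic image of [G], acted on by left translation *)

Section compact_group.
Context {G : topologicalType} (mul : G -> G -> G) (one : G) {T : uniformType}.
Variables (m : T -> T -> T) (i : T -> T) (e : T) (iota : G -> T).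
Hypotheses (cT : compact [set: T]) (hT : hausdorff_space T).
Hypotheses (mA : associative m) (m1 : left_id e m) (mV : left_inverse e i m).
Hypothesis cm : continuous (fun p : T * T => m p.1 p.2).
Hypothesis ciota : continuous iota.
Hypothesis iotaM : forall g h, iota (mul g h) = m (iota g) (iota h).
(** Density is stated as an induction principle: a closed property that holds on the image of [iota]
    holds everywhere. *)
Hypothesis dense_iota :
  forall D : set T, closed D -> (forall g, D (iota g)) -> forall p, D p.

Let b (g : G) (p : T) : T := m (iota g) p.
Let K := ds_Aut b.

Let mVr : right_inverse e i m.
Proof.
move=> p; have h : m (i (i p)) (i p) = e by rewrite mV.
by rewrite -[LHS]m1 -h -mA (mA (i p)) mV m1.
Qed.

Let mr1 : right_id e m.
Proof. by move=> p; rewrite -(mV p) mA mVr m1. Qed.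

Let iV p q : m p q = e -> q = i p.
Proof. by move=> pq; rewrite -[q]m1 -(mV p) -mA pq mr1. Qed.

Let iK : involutive i.
Proof. by move=> p; apply/esym/iV/mV. Qed.

Let iM p q : i (m p q) = m (i q) (i p).
Proof. by apply/esym/iV; rewrite mA -(mA p) mVr mr1 mVr. Qed.

Lemma mulr_continuous q : continuous (m q).
Proof.
move=> p; apply: (continuous_comp (f := fun p => (q, p)) (g := fun p => m p.1 p.2)).
  by apply: cvg_pair; [exact: cvg_cst|exact: cvg_id].
exact: cm.
Qed.

Lemma mull_continuous q : continuous (m^~ q).
Proof.
move=> p; apply: (continuous_comp (f := fun p => (p, q)) (g := fun p => m p.1 p.2)).
  by apply: cvg_pair; [exact: cvg_id|exact: cvg_cst].
exact: cm.
Qed.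

(** The graph of [i] is the closed set where [m p q = e]; the preimage of a closed [A] is the
    projection of the part of the graph over [A], and projection along a compact factor is
    closed. *)
Lemma group_inverse_continuous : continuous i.
Proof.
apply/continuous_closedP => A cA.
pose C := [set p : T * T | m p.1 p.2 = e] `&` snd @^-1` A.
suff -> : i @^-1` A = fst @` C.
  apply: closed_fst_image => //; apply: closedI.
    by apply: closed_eq_continuous => //; move=> ?; exact: cvg_cst.
  by apply: preimage_closed => // ? _; exact: cvg_snd.
apply/seteqP; split => [p Ap|_ [[p q] [/= pq Aq]] <-]; last by rewrite /= -(iV _ _ pq).
by exists (p, i p) => //; split => //; exact: mVr.
Qed.

Definition rtrans (q : T) : {uniform T -> T} := fun p => m p q.

(** Compactness of [T] makes the joint continuity of [m] uniform in the first variable. *)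
Lemma rtrans_continuous : continuous rtrans.
Proof.
move=> q A /uniform_nbhs [U [entU UA]].
suff : \forall q' \near q, [set: T] `<=` (fun r => U (m r q, m r q')).
  by apply: filterS => q' h; apply: UA => r _; exact: h.
apply: (iffLR (compact_near_coveringP _) cT) => r _.
pose V := split_ent U.
have entV : entourage V by exact: entourage_split_ent.
have := cm (r, q) _ (nbhs_entourage _ (entourage_invI entV)).
case=> -[/= A1 A2] [A1r A2q] sub.
exists (A1, A2) => //= -[r' q'] /= [A1r' A2q'].
have /= /xsectionP[_ h1] := sub (r', q) (conj A1r' (nbhs_singleton A2q)).
have /= /xsectionP[h2 _] := sub (r', q') (conj A1r' A2q').
exact: entourage_split h1 h2.
Qed.

Lemma rtrans_aut q : K (rtrans q).
Proof.
split; last by move=> g p; rewrite /rtrans /b mA.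
split; first exact: mull_continuous.
exists (m^~ (i q)); split; first exact: mull_continuous.
  by move=> p; rewrite /rtrans -mA mVr mr1.
by move=> p; rewrite /rtrans -mA mV mr1.
Qed.

(** Equivariance gives [k (iota g) = m (iota g) (k e)], so the two continuous maps agree on a dense
    set. *)
Lemma aut_rtrans k : K k -> k = rtrans (k e).
Proof.
move=> [[ck _] kb]; apply/funext => p; pose D := [set p | k p = rtrans (k e) p].
apply: (dense_iota D); first by apply: closed_eq_continuous => //; exact: mull_continuous.
by move=> g; rewrite /D /= -{1}[iota g]mr1 kb.
Qed.

Lemma aut_compact : compact K.
Proof.
suff -> : K = rtrans @` [set: T] by apply: compact_image => //; exact: rtrans_continuous.
apply/seteqP; split => [k /aut_rtrans ->|_ [q _ <-]]; first by exists (k e).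
exact: rtrans_aut.
Qed.

Lemma aut_transitive p q : exists2 k, K k & q = k p.
Proof.
by exists (rtrans (m (i p) q)); [exact: rtrans_aut|rewrite /rtrans mA mVr m1].
Qed.

Lemma aut_free k x : K k -> k x = x -> k = id.
Proof.
move=> /aut_rtrans ->; rewrite /rtrans => kx; apply/funext => p /=.
suff -> : k e = e by rewrite mr1.
by have := congr1 (m (i x)) kx; rewrite mA mV m1.
Qed.

(** For [p] in [B], the [r] with [m r p] in [B] form a closed set containing all [iota g], hence all
    of [T]; taking [r = m q (i p)] reaches any [q]. *)
Lemma translation_minimal (B : set T) : B !=set0 -> closed B ->
  (forall g p, B p -> B (b g p)) -> B = setT.
Proof.
move=> [p Bp] cB iB; apply/seteqP; split => // q _.
have := dense_iota (m^~ p @^-1` B) _ _ (m q (i p)); rewrite /= -mA mV mr1; apply.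
  by move/continuous_closedP: (mull_continuous p); apply.
by move=> g; exact: iB.
Qed.

(** Automorphisms act transitively, so the orbit space is a single point, where proximality is
    trivial. *)
Lemma aut_extension : exists (Y : topologicalType) (c : G -> Y -> Y) (pi : T -> Y),
  K_extension mul one b K c pi /\ proximal c.
Proof.
exists (discrete_topology unit), (fun _ y => y), (fun _ => tt).
have openY (A : set (discrete_topology unit)) : open A by exact: discrete_open.
split; last first.
  move=> [] []; exists (nbhs one); split; first exact: nbhs_pfilter.
  by exists tt; split; exact: cvg_cst.
split; last split; last by move=> k x; exact: aut_free.
  split.
  - split; [|exact: discrete_hausdorff|split => //].
      have -> : [set: discrete_topology unit] = [set tt] by apply/seteqP; split=> -[].
      exact: compact_set1.
    by move=> ?; exact: cvg_snd.
  - by move=> ?; exact: cvg_cst.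
  - by case; exists e.
  - by [].
  - by move=> x x'; split => // _; exact: aut_transitive.
move=> A; split => // _.
have [At|At] := pselect (A tt).
  by rewrite (_ : _ @^-1` _ = setT)//; [exact: openT|apply/seteqP; split].
by rewrite (_ : _ @^-1` _ = set0)//; [exact: open0|apply/seteqP; split].
Qed.

(* Right translation reverses products, hence the inverses in both
   [J g = rtrans (iota g)^-1] and [theta (rtrans q) = q^-1]. *)
Lemma translation_modelP : translation_model mul b K.
Proof.
exists (fun k => i (val k e)), (fun g => rtrans (i (iota g))).
split; last first.
  by move=> g k k' ->; rewrite /b /= /rtrans iM iK.
split.
- split.
    move=> k; apply: (continuous_comp (f := fun k : K => val k e)); last first.
      exact: group_inverse_continuous.
    have /= := @initial_continuous K {uniform T -> T} set_val k.
    move=> /pointwise_uniform_cvg /pointwise_cvgP /(_ e) h.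
    by apply: h; exact: (@fmap_filter _ _ _ _ (nbhs_filter k)).
  exists (fun q => exist _ (rtrans (i q)) (mem_set (rtrans_aut (i q)))); split.
  + apply: continuous_comp_initial => q.
    apply: (continuous_comp (f := i)); first exact: group_inverse_continuous.
    exact: rtrans_continuous.
  + by move=> k; apply: val_inj; rewrite /= iK -aut_rtrans //; exact: set_valP.
  + by move=> q; rewrite /= /rtrans m1 iK.
- by move=> g; exact: rtrans_aut.
- move=> g; apply: (continuous_comp (f := i \o iota)); last exact: rtrans_continuous.
  by apply: continuous_comp; [exact: ciota|exact: group_inverse_continuous].
- by move=> g h; apply/funext => p; rewrite /rtrans /= iotaM iM mA.
(* As a double inverse, [k e] puts [k] in the range of the continuous map [rtrans \o i], which
   carries the image of [iota] onto the range of [J]. *)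
- move=> k /aut_rtrans ->; rewrite -[k e]iK.
  apply: (dense_iota ((rtrans \o i) @^-1` closure (range (fun g => rtrans (i (iota g)))))).
    have cr : continuous (rtrans \o i).
      move=> q; apply: continuous_comp; first exact: group_inverse_continuous.
      exact: rtrans_continuous.
    by move/continuous_closedP: cr; apply; exact: closed_closure.
  by move=> g; apply: subset_closure; exists g.
Qed.

(** Since [b g q = rtrans q (iota g)], continuity of [rtrans] in the uniform topology is already
    uniform in [g]. *)
Lemma translation_equicontinuous : equicontinuous_system b.
Proof.
move=> p U entU.
have : \forall q \near p, forall r, [set: T] r -> U (rtrans p r, rtrans q r).
  apply: (rtrans_continuous p [set h | forall r, [set: T] r -> U (rtrans p r, h r)]).
  by apply/uniform_nbhs; exists U; split.
by apply: filterS => q h g; exact: h.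
Qed.

Definition ltrans (p : T) : {ptws T -> T} := m p.

Lemma ltrans_continuous : continuous ltrans.
Proof. by apply: ptws_continuous => q; exact: mull_continuous. Qed.

Lemma ltrans_enveloping p : enveloping b (ltrans p).
Proof.
apply: (dense_iota (ltrans @^-1` closure (range (fun g => b g : {ptws T -> T})))).
  by move/continuous_closedP: ltrans_continuous; apply; exact: closed_closure.
by move=> g; apply: subset_closure; exists g.
Qed.

(** Being the left translation by one's value at [e] is a pointwise closed condition, and each [b g]
    satisfies it. *)
Lemma enveloping_ltrans r : enveloping b r -> r = ltrans (r e).
Proof.
move=> br; suff : closed [set r : {ptws T -> T} | r = ltrans (r e)].
  move=> cl; apply: cl; apply: closureS br => _ [g _ <-] /=.
  by apply/funext => p; rewrite /ltrans /b mr1.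
apply: closed_eq_continuous => //.
- exact: hausdorff_product.
- by move=> ?; exact: cvg_id.
- move=> s; apply: (continuous_comp (f := fun s : {ptws T -> T} => s e) (g := ltrans)).
    exact: (@proj_continuous T (fun=> T) e).
  exact: ltrans_continuous.
Qed.

Definition ltrans_env (p : T) : set_type (enveloping b) :=
  exist _ (ltrans p) (mem_set (ltrans_enveloping p)).

Lemma ltrans_env_homeo : homeo ltrans_env.
Proof.
split; first by apply: continuous_comp_initial; exact: ltrans_continuous.
exists (fun r => val r e); split.
- move=> r; apply: (continuous_comp (f := set_val) (g := fun s : {ptws T -> T} => s e)).
    exact: initial_continuous.
  exact: (@proj_continuous T (fun=> T) e).
- by move=> p; rewrite /= /ltrans mr1.
- by move=> r; apply: val_inj; rewrite /= -enveloping_ltrans //; exact: set_valP.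
Qed.

End compact_group.

(** * Baire category and closed entourages *)

Lemma compact_baire {X : uniformType} (A : nat -> set X) :
  compact [set: X] -> [set: X] !=set0 -> (forall n, closed (A n)) ->
  (forall x, exists n, A n x) -> exists n, (A n)° !=set0.
Proof.
move=> cX [x0 _] clA covA; apply: contrapT => /forallNP intA.
pose S := {V : set X | open V /\ V !=set0}.
have step (nV : nat * S) : exists V' : S,
    closure (sval V') `<=` sval nV.2 `\` A nV.1.
  case: nV => n [V [oV [v Vv]]] /=.
  have [x [Vx nAx]] : exists x, V x /\ ~ A n x.
    apply: contrapT => /forallNP VA; apply: (intA n); exists v.
    apply: (@filterS _ _ _ V); last exact: open_nbhs_nbhs.
    by move=> x Vx; apply: contrapT => nAx; apply: (VA x).
  have /uniform_regular[W Wx WV] : nbhs x (V `\` A n).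
    by apply: open_nbhs_nbhs; split => //; apply: openI => //; exact: closed_openC.
  have W'0 : open W° /\ W° !=set0 by split; [exact: open_interior|exists x].
  exists (exist _ W° W'0) => /=; apply: subset_trans WV.
  by apply: closureS; exact: interior_subset.
have [f fP] := choice step.
have T0 : open [set: X] /\ [set: X] !=set0 by split; [exact: openT|exists x0].
(* If every [A n] had empty interior, this shrinking sequence would satisfy [closure (v n.+1)]
   inside [v n] minus [A n]. *)
pose v := fix v n : S := if n is n'.+1 then f (n', v n') else exist _ setT T0.
have vS n : closure (sval (v n.+1)) `<=` sval (v n) `\` A n := fP (n, v n).
have vle n k : sval (v (n + k)%N) `<=` sval (v n).
  elim: k => [|k IH]; first by rewrite addn0.
  rewrite addnS; apply: subset_trans IH => x /subset_closure vx.
  by case: (vS _ _ vx).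
pose F := filter_from [set: nat] (fun n => sval (v n)).
have PF : ProperFilter F.
  apply: filter_from_proper; last by move=> n _; case: (svalP (v n)).
  apply: filter_from_filter; first by exists 0%N.
  move=> j k _ _; exists (j + k)%N => // x vx; split; first exact: vle vx.
  by apply: (vle _ j); rewrite addnC.
(* A cluster point lies in every [closure (v n.+1)], hence in no [A n], against the covering. *)
have [x [_ clx]] := cX F PF filterT.
have [n Anx] := covA x.
suff /vS[] : closure (sval (v n.+1)) x by [].
by move=> B xB; apply: clx => //; exists n.+1.
Qed.

(** A point of [closure V] is joined by three [V]-steps, hence two splittings of [U]. *)
Lemma closed_sub_entourage {X : uniformType} (U : set (X * X)) : entourage U ->
  exists W, [/\ entourage W, closed W & W `<=` U].
Proof.
move=> entU; pose V := split_ent (split_ent U).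
have entV : entourage V by do 2 apply: entourage_split_ent.
exists (closure V); split; [|exact: closed_closure|].
  by apply: filterS entV; exact: subset_closure.
move=> [x y] clV.
have nxy : nbhs (x, y) (xsection V x `*` xsection V^-1%relation y).
  exists (xsection V x, xsection V^-1%relation y) => //.
  by split; [exact: nbhs_entourage|exact: (nbhs_entourage y (entourage_inv entV))].
have [[a b] [Vab [/= /xsectionP Vxa /xsectionP Vby]]] := clV _ nxy.
apply: (entourage_split a entU); last exact: (entourage_split b).
by apply: split_ent_subset => //; exact: entourage_split_ent.
Qed.

(** * The enveloping semigroup as a compact metric space *)

Section metrizable_enveloping.
Local Open Scope ring_scope.
Context {G : topologicalType} {X : uniformType} (act : G -> X -> X).
Local Notation E := (set_type (enveloping act)).
Local Notation R := Rdefinitions.R.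

Lemma act_enveloping g : enveloping act (act g).
Proof. by apply: subset_closure; exists g. Qed.

Definition to_enveloping (g : G) : E :=
  exist _ (act g : {ptws X -> X}) (mem_set (act_enveloping g)).

Lemma enveloping_dense (D : set E) : closed D -> (forall g, D (to_enveloping g)) ->
  forall p, D p.
Proof.
move=> cD Dg p; apply: cD => B [/= _ [[W oW <-] /= Wp] WB].
have /(_ W)[|_ [[g _ <-] Wg]] := set_valP p; first exact: open_nbhs_nbhs.
by exists (to_enveloping g); split; [exact: Dg|exact: WB].
Qed.

Lemma enveloping_eval_continuous x : continuous (fun p : E => val p x).
Proof.
move=> p; apply: (continuous_comp (f := set_val) (g := fun s : {ptws X -> X} => s x)).
  exact: initial_continuous.
exact: (@proj_continuous X (fun=> X) x).
Qed.

Lemma enveloping_compact : compact [set: X] -> hausdorff_space X -> compact [set: E].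
Proof.
move=> cX hX.
have cE : compact (enveloping act).
  apply: (@subclosed_compact _ _ setT); first exact: closed_closure.
    have := @tychonoff X (fun=> X) (fun=> setT) (fun=> cX).
    by congr compact; apply/seteqP; split.
  by [].
(* Compactness passes from the subset of the product to the subtype by pushing the filter along
   [set_val]. *)
move=> F PF _.
have FE : (set_val @ F) (enveloping act).
  by apply: (@filterS _ F _ setT); [move=> p _; exact: set_valP|exact: filterT].
have [p [Ep clp]] := cE _ _ FE.
exists (exist _ p (mem_set Ep)); split => // A B FA [/= _ [[W oW <-] /= Wp] WB].
have FA' : (set_val @ F) (set_val @` A).
  by apply: (@filterS _ F _ A) => // a Aa; exists a.
have [_ [[a Aa <-] Wa]] := clp _ _ FA' (open_nbhs_nbhs (conj oW Wp)).
by exists a; split => //; exact: WB.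
Qed.

Lemma enveloping_hausdorff : hausdorff_space X -> hausdorff_space E.
Proof.
move=> hX p q pq; apply: val_inj; apply/funext => x; apply: hX => A B pA qB.
have [r [rA rB]] := pq _ _ (enveloping_eval_continuous x p A pA)
  (enveloping_eval_continuous x q B qB).
by exists (val r x).
Qed.

Variable (d : E -> E -> R).
Hypothesis d0 : forall p q, d p q = 0 <-> p = q.
Hypothesis dD : forall p q r, d p r <= d p q + d q r.
Hypothesis dopen : forall A : set E, open A <->
  forall p, A p -> exists2 e : R, 0 < e & [set q | d p q < e] `<=` A.

Lemma metric_ball_nbhs p (e : R) : 0 < e -> nbhs p [set q | d p q < e].
Proof.
move=> e0; apply: open_nbhs_nbhs; split; last by rewrite /= (d0 p p).2.
apply/dopen => q /= pq; exists (e - d p q); first by rewrite subr_gt0.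
by move=> r /= qr; apply: le_lt_trans (dD _ q _) _; rewrite addrC -ltrBrDr.
Qed.

Lemma metric_nbhs_ball p A : nbhs p A ->
  exists2 e : R, 0 < e & [set q | d p q < e] `<=` A.
Proof.
rewrite nbhsE => -[B [oB Bp] BA]; have [e e0 eB] := (dopen B).1 oB p Bp.
by exists e => //; exact: subset_trans BA.
Qed.

(** Heine's theorem for evaluation at [x], with the modulus taken of the form [1/(n+1)]. *)
Lemma metric_eval_uniform x (W : set (X * X)) : compact [set: E] -> entourage W ->
  exists n : nat, forall p q, d p q < n.+1%:R^-1 -> W (val p x, val q x).
Proof.
move=> cE entW.
have : \forall n \near \oo, [set: E] `<=`
    (fun p => forall q, d p q < n.+1%:R^-1 -> W (val p x, val q x)).
  apply: (iffLR (compact_near_coveringP _) cE) => p _.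
  have /enveloping_eval_continuous/metric_nbhs_ball[e e0 eW] :=
    nbhs_entourage (val p x) (entourage_invI (entourage_split_ent entW)).
  have e20 : 0 < e / 2 by rewrite divr_gt0.
  (* With these halves both [q] and any [r] at distance less than [1/(n+1)] from [q] stay in the
     [e]-ball around [p]. *)
  exists ([set q | d p q < e / 2], [set n : nat | n.+1%:R^-1 < e / 2]).
    split; first exact: metric_ball_nbhs.
    have [k] := ltr_add_invr e20; rewrite add0r => ke.
    exists k => // n /= kn; apply: le_lt_trans ke.
    by rewrite lef_pV2 ?posrE// ler_nat.
  move=> [q n] /= [pq ne] r qr.
  have /xsectionP[_ h1] :
      xsection (split_ent W `&` (split_ent W)^-1%relation) (val p x) (val q x).
    apply: eW => /=; apply: lt_trans pq _; rewrite ltr_pdivrMr// mulr_natr mulr2n.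
    by rewrite ltrDl.
  have /xsectionP[h2 _] :
      xsection (split_ent W `&` (split_ent W)^-1%relation) (val p x) (val r x).
    apply: eW => /=; apply: le_lt_trans (dD _ q _) _.
    by rewrite [e]splitr ltrD// (lt_trans qr).
  exact: entourage_split h1 h2.
by case/filter_ex => n h; exists n => p q; exact: h.
Qed.

End metrizable_enveloping.

(** * Equicontinuity of the system and the group structure of its enveloping semigroup *)

Section enveloping_group.
Context {G : topologicalType} (mul : G -> G -> G) (inv : G -> G) (one : G).
Context {X : uniformType} (act : G -> X -> X).
Hypotheses (topG : is_topgroup mul inv one) (dsX : dyn_system mul one act).
Local Notation E := (set_type (enveloping act)).
Local Notation iota := (to_enveloping act).

Let cX : compact [set: X]. Proof. by case: dsX. Qed.
Let hX : hausdorff_space X. Proof. by case: dsX. Qed.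
Let act1 x : act one x = x. Proof. by case: dsX => _ _ []. Qed.
Let actM g h x : act (mul g h) x = act g (act h x).
Proof. by case: dsX => _ _ []. Qed.
Let cact : continuous (fun p : G * X => act p.1 p.2).
Proof. by case: dsX => _ _ []. Qed.
Let mulVg g : mul (inv g) g = one. Proof. by case: topG => -[]. Qed.

Let cactr g : continuous (act g).
Proof.
move=> x; apply: (continuous_comp (f := fun x => (g, x)) (g := fun p => act p.1 p.2)).
  by apply: cvg_pair; [exact: cvg_cst|exact: cvg_id].
exact: cact.
Qed.

Let cactl x : continuous (act^~ x).
Proof.
move=> g; apply: (continuous_comp (f := fun g => (g, x)) (g := fun p => act p.1 p.2)).
  by apply: cvg_pair; [exact: cvg_id|exact: cvg_cst].
exact: cact.
Qed.

(** The points whose whole orbit avoids [V] form a closed invariant set that misses [V], so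
    minimality forces it to be empty. *)
Lemma minimal_orbit_meets (V : set X) x : minimal_system act ->
  open V -> V !=set0 -> exists g, V (act g x).
Proof.
move=> [_ _ _ minX] oV [v Vv]; apply: contrapT => /forallNP nV.
pose B := [set y | forall g, ~ V (act g y)].
have BT : B = setT.
  apply: minX => //; first by exists x.
    have -> : B = \bigcap_g (act g @^-1` (~` V)).
      by apply/seteqP; split => [y By g _|y By g]; exact: By.
    apply: closed_bigI => g _.
    by move/continuous_closedP: (cactr g); apply; exact: open_closedC.
  by move=> g y By h; rewrite -actM; exact: By.
have /(_ one) : B v by rewrite BT.
by rewrite act1.
Qed.

Lemma metrizable_equicontinuous : minimal_system act -> metrizable E ->
  equicontinuous_system act.
Proof.
move=> minX [d [d0 dC dD dopen]] x U entU.
have cE : compact [set: E] by exact: enveloping_compact.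
(* [U'] is symmetric because the final transport compares two points through [x0]; [U3] leaves room
   for the three-step chain at [x0]. *)
pose U2 := split_ent U; have entU2 : entourage U2 by exact: entourage_split_ent.
pose U' := U2 `&` U2^-1%relation; have entU' : entourage U' := entourage_invI entU2.
pose U3 := split_ent (split_ent U').
have entU3 : entourage U3 by do 2 apply: entourage_split_ent.
have [W [entW clW WU]] := closed_sub_entourage _ (entourage_invI entU3).
pose A n := [set y | forall g h, (d (iota g) (iota h) < n.+1%:R^-1)%R ->
                     W (act g y, act h y)].
have [n [x0 Ax0]] : exists n, (A n)° !=set0.
  apply: compact_baire => //; first by case: minX.
    move=> n; have -> : A n = \bigcap_(gh in [set gh : G * G |
        (d (iota gh.1) (iota gh.2) < n.+1%:R^-1)%R])
        ((fun y => (act gh.1 y, act gh.2 y)) @^-1` W).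
      by apply/seteqP; split => [y Ay [g h] /= /Ay|y Ay g h gh]//; exact: (Ay (g, h)).
    apply: closed_bigI => -[g h] _; apply: preimage_closed => // y _.
    by apply: cvg_pair; exact: cactr.
  move=> y; have [n nW] := metric_eval_uniform act d d0 dD dopen y W cE entW.
  by exists n => g h gh; exact: (nW _ _ gh).
(* Near-covering over [E] replaces a finite net of group elements; the equation [p = iota g]
   restricts the conclusion to the image of [G]. *)
have Ueq : \forall y \near x0, [set: E] `<=`
    (fun p => forall g, p = iota g -> U' (act g x0, act g y)).
  apply: (iffLR (compact_near_coveringP _) cE) => p _.
  pose e : Rdefinitions.R := (n.+1%:R^-1 / 2)%R.
  have e0 : (0 < e)%R by rewrite divr_gt0 ?invr_gt0.
  have [_ [[g _ <-] pg]] : exists q, range iota q /\ (d p q < e)%R.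
    have := enveloping_dense act (closure (range iota)) (@closed_closure _ _) _ p.
    apply; first by move=> g; apply: subset_closure; exists g.
    exact: (metric_ball_nbhs act d d0 dD dopen).
  (* For [iota h] in this ball, the chain is [h x0], [g x0], [g y], [h y]: the outer links come from
     [A n] since [d (iota h) (iota g) < 2 * e], the middle one from continuity of [act g]. *)
  exists ([set q | (d p q < e)%R], A n `&` act g @^-1` xsection W (act g x0)).
    split; first exact: (metric_ball_nbhs act d d0 dD dopen).
    by apply: filterI => //; apply: (cactr g); exact: nbhs_entourage.
  move=> [q y] /= [pq [Ay /xsectionP gy]] h qh.
  have hg : (d (iota h) (iota g) < n.+1%:R^-1)%R.
    rewrite -qh [ltRHS]splitr; apply: le_lt_trans (dD _ p _) _.
    by rewrite ltrD// dC.
  apply: (entourage_split (act g x0)) => //.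
    by apply: split_ent_subset; last by case: (WU _ (nbhs_singleton Ax0 h g hg)).
  apply: (entourage_split (act g y)); first exact: entourage_split_ent.
    by case: (WU _ gy).
  by case: (WU _ (Ay h g hg)).
pose V := [set y | forall g, U' (act g x0, act g y)]°.
have V0 : V x0.
  by apply: filterS Ueq => y Uy g; exact: (Uy (iota g)).
have [|//|g0 Vg0] := minimal_orbit_meets V x minX; first exact: open_interior.
  by exists x0.
have : nbhs x (act g0 @^-1` V).
  by apply: cactr; apply: open_nbhs_nbhs; split => //; exact: open_interior.
apply: filterS => y /= /interior_subset Vy g.
(* Since [act g0] carries [x] and nearby [y] into [V], the uniform estimate over the group at [x0]
   is applied to [mul g (inv g0)]. *)
have gE z : act g z = act (mul g (inv g0)) (act g0 z).
  by rewrite actM -(actM (inv g0)) mulVg act1.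
rewrite !gE; apply: (entourage_split (act (mul g (inv g0)) x0)) => //.
  by case: (interior_subset Vg0 (mul g (inv g0))).
by case: (Vy (mul g (inv g0))).
Qed.

(** Density is used in one factor at a time: first the left factor is some [act g], which is
    continuous; then the left factor varies, and precomposition with a fixed map is pointwise
    continuous. *)
Lemma enveloping_comp p q : enveloping act p -> enveloping act q ->
  enveloping act (p \o q : {ptws X -> X}).
Proof.
have compl g (r : E) : enveloping act (act g \o val r : {ptws X -> X}).
  pose f (r : E) : {ptws X -> X} := act g \o val r.
  apply: (enveloping_dense act (f @^-1` enveloping act)); last first.
    move=> h; have := act_enveloping act (mul g h).
    by rewrite (_ : act (mul g h) = f (iota h)) //; apply/funext => x; rewrite actM.
  suff cf : continuous f.
    by move/continuous_closedP: cf; apply; exact: closed_closure.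
  apply: ptws_continuous => x s.
  apply: (continuous_comp (f := fun r : E => val r x) (g := act g)); last exact: cactr.
  exact: enveloping_eval_continuous.
move=> Ep Eq; pose f (r : E) : {ptws X -> X} := val r \o q.
apply: (enveloping_dense act (f @^-1` enveloping act) _ _
  (exist _ p (mem_set Ep))); last first.
  by move=> h; exact: (compl h (exist _ q (mem_set Eq))).
suff cf : continuous f.
  by move/continuous_closedP: cf; apply; exact: closed_closure.
by apply: ptws_continuous => x; exact: enveloping_eval_continuous.
Qed.

Definition emul (p q : E) : E :=
  exist _ (val p \o val q : {ptws X -> X})
    (mem_set (enveloping_comp _ _ (set_valP p) (set_valP q))).

Lemma emulA : associative emul.
Proof. by move=> p q r; apply: val_inj. Qed.

Lemma emul1 : left_id (iota one) emul.
Proof. by move=> p; apply: val_inj; apply/funext => x; rewrite /= act1. Qed.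

Lemma to_envelopingM g h : iota (mul g h) = emul (iota g) (iota h).
Proof. by apply: val_inj; apply/funext => x; rewrite /= actM. Qed.

Lemma to_enveloping_continuous : continuous iota.
Proof.
by apply/continuous_comp_initial/ptws_continuous => x; exact: cactl.
Qed.

(** As [enveloping act] is invariant, the default branch of [ds_restrict] never occurs. *)
Lemma restrict_lmulE :
  ds_restrict (lmul act) (enveloping act) = (fun g p => emul (iota g) p).
Proof.
apply/funext => g; apply/funext => p; apply: val_inj; rewrite /ds_restrict.
by case: pselect => // -[]; exact: enveloping_comp (act_enveloping act g) (set_valP p).
Qed.

Hypothesis eqX : equicontinuous_system act.

(** Compactness of [X] makes equicontinuity uniform in the base point; a closed [W] inside [U] lets
    the bound pass from [G] to the limits in [E]. *)
Lemma enveloping_uniform (U : set (X * X)) : entourage U ->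
  \forall xy \near entourage, forall p : E, U (val p xy.1, val p xy.2).
Proof.
move=> entU; have [W [entW clW WU]] := closed_sub_entourage _ entU.
have : \forall xy \near @entourage X, [set: X] `<=`
    (fun z => z = xy.1 -> forall g, W (act g xy.1, act g xy.2)).
  apply: (iffLR (compact_near_coveringP _) cX) => z _.
  have entW' := entourage_invI (entourage_split_ent entW).
  have /nbhsP[V entV VW] := eqX z _ entW'.
  exists (xsection (split_ent V) z, split_ent V).
    by split; [exact: nbhs_entourage|exact: entourage_split_ent].
  move=> [z' [x y]] /= [/xsectionP zz' xy] z'x g; rewrite z'x in zz'.
  have /VW/(_ g)[_ h1] : xsection V z x by apply/xsectionP; exact: split_ent_subset.
  have /VW/(_ g)[h2 _] : xsection V z y by apply/xsectionP; exact: entourage_split zz' xy.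
  exact: entourage_split h1 h2.
apply: filterS => -[x y] /(_ x I erefl) /= Wxy p; apply: WU.
apply: (enveloping_dense act [set p : E | W (val p x, val p y)]) => //.
apply: (@preimage_closed _ _ (fun p : E => (val p x, val p y))) => // q _.
by apply: continuous_pair; exact: enveloping_eval_continuous.
Qed.

(** From [p (q x)] to [p' (q x)] by pointwise closeness of [p'] to [p], then to [p' (q' x)] by the
    equicontinuity of all of [E]. *)
Lemma emul_continuous : continuous (fun p : E * E => emul p.1 p.2).
Proof.
apply/continuous_comp_initial/ptws_continuous => x -[p q].
apply/cvg_entourageP => U entU.
have := enveloping_uniform _ (entourage_split_ent entU).
move=> ueq; have nq : \forall q' \near q, forall r : E,
    split_ent U (val r (val q x), val r (val q' x)).
  have nqx := enveloping_eval_continuous act x q _ (nbhs_entourage _ ueq).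
  by apply: (@filterS _ (nbhs q) _ _ _ _ nqx) => q' /xsectionP.
have np := @enveloping_eval_continuous _ _ act (val q x) p _
  (nbhs_entourage _ (entourage_split_ent entU)).
exists ((fun p' : E => val p' (val q x)) @^-1` xsection (split_ent U) (val p (val q x)),
  [set q' | forall r : E, split_ent U (val r (val q x), val r (val q' x))]) => //.
move=> [p' q'] /= [/xsectionP h1 h2].
exact: entourage_split h1 (h2 p').
Qed.

(* The elements of the compact space [E] having a left inverse form the
   projection of a closed subset of [E * E], hence a closed set, and it
   contains the image of [G]. *)
Lemma emul_left_inverse : exists i : E -> E, left_inverse (iota one) i emul.
Proof.
suff /choice[i iV] : forall p, exists q, emul q p = iota one by exists i.
move=> p; pose C := [set pq : E * E | emul pq.2 pq.1 = iota one].
suff [[p' q] /= pq <-] : (fst @` C) p by exists q.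
have cE : compact [set: E] by exact: enveloping_compact.
have hE : hausdorff_space E by exact: enveloping_hausdorff.
apply: (enveloping_dense act).
  apply: closed_fst_image => //; apply: closed_eq_continuous => //.
    move=> pq; apply: (continuous_comp (f := fun pq : E * E => (pq.2, pq.1))
        (g := fun p : E * E => emul p.1 p.2)).
      by apply: continuous_pair => ?; [exact: cvg_snd|exact: cvg_fst].
    exact: emul_continuous.
  by move=> ?; exact: cvg_cst.
move=> g; exists (iota g, iota (inv g)) => //.
by rewrite /C /= -to_envelopingM mulVg.
Qed.

End enveloping_group.

(** * Assembly of the six claims with [I] equal to the whole enveloping semigroup *)

Theorem mainTheorem9 (G : topologicalType) (mul : G -> G -> G) (inv : G -> G)
    (one : G) (X : uniformType) (act : G -> X -> X) :
  is_topgroup mul inv one ->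
  dyn_system mul one act ->
  minimal_system act ->
  metrizable (set_type (enveloping act)) ->
  exists I : set {ptws X -> X},
    let b := ds_restrict (lmul act) I in
    let K := ds_Aut b in
    [/\ (* (1) unique minimal left ideal, and E(X) ~= E(I) *)
        minimal_left_ideal act I /\
          (forall I', minimal_left_ideal act I' -> I' = I),
        enveloping_iso act b,
        (* (2) K = Aut(I,G) with the uniform topology is compact *)
        compact K,
        (* (3),(4) I -> I/K is a K-extension and (I/K, G) is proximal *)
        (exists (Y : topologicalType) (c : G -> Y -> Y) (pi : set_type I -> Y),
           K_extension mul one b K c pi /\ proximal c) &
        (* (5) incontractible case *)
        (incontractible act ->
           [/\ (forall p q : set_type I, exists2 k, K k & q = k p),
               translation_model mul b K,
               equicontinuous_system b &
               equicontinuous_system act])] /\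
    (* (6) commutative case *)
    (commutative mul ->
       [/\ (exists psi : set_type I -> X,
              homeo psi /\ forall g p, psi (b g p) = act g (psi p)),
           translation_model mul b K &
           (forall k k', K k -> K k' ->
              (k \o k' : {uniform set_type I -> set_type I}) = k' \o k)]).
Proof.
move=> topG dsX minX metE.
have eqX := metrizable_equicontinuous mul inv one act topG dsX minX metE.
have [cX hX [cact act1 actM]] := dsX.
pose iota := to_enveloping act.
pose m := emul mul one act dsX; pose e : set_type (enveloping act) := iota one.
have [i mV] := emul_left_inverse mul inv one act topG dsX eqX.
have cE : compact [set: set_type (enveloping act)] by exact: enveloping_compact.
have hE : hausdorff_space (set_type (enveloping act)) by exact: enveloping_hausdorff.
have mA : associative m := emulA mul one act dsX.
have m1 : left_id e m := emul1 mul one act dsX.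
have cm : continuous (fun p : set_type (enveloping act) * set_type (enveloping act) =>
    m p.1 p.2).
  exact (emul_continuous mul one act dsX eqX).
have ciota : continuous iota := to_enveloping_continuous mul one act dsX.
have iotaM : forall g h, iota (mul g h) = m (iota g) (iota h).
  exact: to_envelopingM.
have dense_iota := enveloping_dense act.
(* This yields both the minimality of [enveloping act] and the uniqueness of the minimal left
   ideal. *)
have tmin (B : set {ptws X -> X}) : B `<=` enveloping act -> B !=set0 -> closed B ->
    ds_invariant (lmul act) B -> B = enveloping act.
  move=> BE [p Bp] cB iB; apply/seteqP; split => // q Eq.
  have BT : @set_val _ (enveloping act) @^-1` B = setT.
    apply: (translation_minimal m i e iota mA m1 mV cm dense_iota).
    - by exists (exist _ p (mem_set (BE _ Bp))).
    - have := @initial_continuous (set_type (enveloping act)) _ set_val.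
      by move/continuous_closedP; apply.
    - by move=> g r Br; exact: iB.
  have : (@set_val _ (enveloping act) @^-1` B) (exist _ q (mem_set Eq)) by rewrite BT.
  by [].
exists (enveloping act) => /=; rewrite (restrict_lmulE mul one act dsX).
have tmodel : translation_model mul (fun g p => m (iota g) p)
    (ds_Aut (fun g p => m (iota g) p)).
  exact: (translation_modelP mul m i e iota).
split; [split|].
- split.
    split => //; split => //.
    + by exists (act one); exact: act_enveloping.
    + exact: closed_closure.
    + move=> g p Ep; apply: (enveloping_comp mul one act dsX) => //.
      exact: act_enveloping.
  by move=> I' [I'E [I'0 cI' iI' _]]; exact: tmin.
- exists (ltrans_env m iota cm dense_iota); split.
  + exact: ltrans_env_homeo.
  + move=> p q r pq; apply/funext => s; apply: val_inj => /=.
    by rewrite pq.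
  + move=> g p pg; apply/funext => s; apply: val_inj => /=.
    by rewrite pg.
- exact: (aut_compact m i e iota).
- exact: (aut_extension mul one m i e iota).
- move=> _; split => //.
  + by move=> p q; exact: (aut_transitive m i e iota).
  + exact: (translation_equicontinuous m iota).
move=> mulC; have mC : commutative m.
  (* Commutation extends from [G] to [E] by density, one variable at a time. *)
  move=> p q; apply: (dense_iota [set p | m p q = m q p]).
    by apply: closed_eq_continuous => //; [exact: mull_continuous|exact: mulr_continuous].
  move=> g; apply: (dense_iota [set q | m (iota g) q = m q (iota g)]).
    by apply: closed_eq_continuous => //; [exact: mulr_continuous|exact: mull_continuous].
  by move=> h; rewrite /= -!iotaM mulC.
split => //; last first.
  have autE := aut_rtrans m i e iota hE mA m1 mV cm dense_iota.
  move=> k k' /autE -> /autE ->; apply/funext => p.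
  by rewrite /rtrans /= -!mA; congr m; exact: mC.
have [[x0 _] _ _ minT] := minX.
pose psi (p : set_type (enveloping act)) := val p x0.
have cpsi : continuous psi by exact: enveloping_eval_continuous.
(* The range of [psi] is compact, hence closed, and invariant, so it is all of [X] by minimality. *)
have psiS x : exists p, psi p = x.
  suff [p _ <-] : range psi x by exists p.
  rewrite (minT (range psi)) //; first by exists (psi e), e.
    by apply: compact_closed => //; exact: compact_image.
  by move=> g _ [p _ <-]; exists (m (iota g) p).
have psiM p q : val p (psi q) = psi (m p q) by [].
(* Every point is some [r x0], and commutativity gives [p (r x0) = r (p x0)], so the value at [x0]
   determines [p]. *)
have psiI : injective psi.
  move=> p q pq; apply: val_inj; apply/funext => x; have [r <-] := psiS x.
  by rewrite !psiM ![m _ r]mC -!psiM pq.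
have [f fK] := choice psiS.
exists psi; split => //.
by apply: (compact_bijection_homeo _ f) => // p; apply: psiI; rewrite fK.
Qed.
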